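(* Let $G$ and $H$ be non-trivial groups, let $H$ act faithfully on a set $X$, and assume that $H_X$ is not of torsion-type. (i) If $G\wr_X H$ is finitely generated and $H$ is FIG, then $G\wr_X H$ is FIG. (ii) If $G\wr_X H$ is not finitely generated and $H$ is FIG, then $G\wr_X H$ is IG. (iii) If $H$ is IG, then $G\wr_X H$ is IG.
   Context: A subset $S$ of a group $K$ invariably generates $K$ if for every choice of elements $a_s\in K$ ($s\in S$) one has $\langle a_s^{-1}sa_s : s\in S\rangle=K$. A group is FIG (finitely invariably generated) if it has a finite invariable generating set. A group is IG if it has an invariable generating set but no finite one (so IG excludes FIG). For non-trivial groups $G,H$ with $H$ acting faithfully (on the right) on a set $X$, the (restricted) wreath product is $G\wr_X H=\left(\bigoplus_{x\in X}G_x\right)\rtimes H$, where each $G_x$ is a copy of $G$, $g^{(x)}$ denotes the element $g\in G$ in $G_x$, and $h^{-1}g^{(x)}h=g^{(xh)}$ for $h\in H$. $H_X\le \mathrm{Sym}(X)$ denotes $H$ together with its faithful action on $X$, and $yH_X$ is the orbit of $y\in X$. $H_X$ is of torsion-type if there exists $y\in X$ such that for all $x\in yH_X$ and all $k\in H_X$, the set $x\langle k\rangle$ is finite. *)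

(* Defs.v *)
From HB Require Import structures.
From mathcomp Require Import all_boot.
From mathcomp Require Import finmap.
From mathcomp Require Import boolp classical_sets cardinality.

Set Implicit Arguments.
Unset Strict Implicit.
Unset Printing Implicit Defensive.

Local Open Scope classical_set_scope.
Local Open Scope group_scope.

Section GeneratedSubgroups.
Variable K : groupType.
Implicit Types A S : set K.

Definition subgroup A : Prop :=
  A 1 /\ forall x y, A x -> A y -> A (x / y).

Definition generated S : set K := smallest subgroup S.

(* [x ^ y] is [y^-1 * (x * y)]; only the values of [a] on [S] matter. *)
Definition invariably_generates S : Prop :=
  forall a : K -> K, generated [set s ^ a s | s in S] = [set: K].

End GeneratedSubgroups.

Definition nontrivial (K : groupType) : Prop := exists x : K, x != 1.

Definition finitely_generated (K : groupType) : Prop :=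
  exists S : set K, finite_set S /\ generated S = [set: K].

Definition FIG (K : groupType) : Prop :=
  exists S : set K, finite_set S /\ invariably_generates S.

Definition IG (K : groupType) : Prop :=
  (exists S : set K, invariably_generates S) /\ ~ FIG K.

Record raction (H : groupType) (X : Type) := RAction {
  ract :> X -> H -> X;
  ract1 : forall x, ract x 1 = x;
  ractM : forall x g h, ract x (g * h) = ract (ract x g) h }.

Section Actions.
Variables (H : groupType) (X : Type) (to : raction H X).

Definition faithful_action : Prop := forall h, (forall x, to x h = x) -> h = 1.

Definition orbit_of (y : X) : set X := [set to y h | h in [set: H]].

Definition torsion_type : Prop :=
  exists y : X, forall x, orbit_of y x -> forall k : H,
    finite_set [set to x g | g in generated [set k]].

End Actions.

(* The pair [Wreath f h] stands for the product of the base element [f], with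
   finite support, and [h].  Since [g^(x)] conjugated by [h] is [g^(x h)], the
   conjugate of [f] by [h^-1] is [fun x => f (x h)]; see [wreath_conj]. *)
Record wreath (G H : groupType) (X : choiceType) (to : raction H X) := Wreath {
  wbase : {fsfun X -> G with 1};
  wtop : H }.

Arguments wreath G {H X} to.
Arguments Wreath {G H X to} wbase wtop.

Section WreathProduct.
Variables (G H : groupType) (X : choiceType) (to : raction H X).
Notation base := {fsfun X -> G with 1}.
Notation W := (wreath G to).
Implicit Types (f : base) (h : H) (u v w : W).

Definition pair_of_wreath u := (wbase u, wtop u).
Definition wreath_of_pair (p : base * H) : W := Wreath p.1 p.2.
Lemma pair_of_wreathK : cancel pair_of_wreath wreath_of_pair.
Proof. by case. Qed.

HB.instance Definition _ := Choice.copy W (can_type pair_of_wreathK).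

Lemma wreathP u v : wbase u =1 wbase v -> wtop u = wtop v -> u = v.
Proof. by case: u v => [f h] [f' h'] /= /fsfunP -> ->. Qed.

Definition wreath_mul u v : W := Wreath
  [fsfun x in (finsupp (wbase u) `|`
               [fset to z (wtop u)^-1 | z in finsupp (wbase v)])%fset
     => wbase u x * wbase v (to x (wtop u))]
  (wtop u * wtop v).

Definition wreath_one : W := Wreath [fsfun] 1.

Definition wreath_inv u : W := Wreath
  [fsfun x in [fset to z (wtop u) | z in finsupp (wbase u)]%fset
     => (wbase u (to x (wtop u)^-1))^-1]
  (wtop u)^-1.

Lemma wbase_mul u v x :
  wbase (wreath_mul u v) x = wbase u x * wbase v (to x (wtop u)).
Proof.
rewrite /= fsfun_fun; case: ifP => // /negbT; rewrite inE negb_or.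
case/andP=> xu xv; rewrite (fsfun_dflt xu) mul1g fsfun_dflt //.
apply: contra xv => xv; apply/imfsetP; exists (to x (wtop u)) => //=.
by rewrite -ractM mulgV ract1.
Qed.

Lemma wbase_one x : wbase wreath_one x = 1.
Proof. by rewrite /= fsfun0E. Qed.

Lemma wbase_inv u x :
  wbase (wreath_inv u) x = (wbase u (to x (wtop u)^-1))^-1.
Proof.
rewrite /= fsfun_fun; case: ifP => // /negbT xu.
rewrite fsfun_dflt ?invg1 //; apply: contra xu => xu.
by apply/imfsetP; exists (to x (wtop u)^-1) => //=; rewrite -ractM mulVg ract1.
Qed.

Lemma wreath_mulA : associative wreath_mul.
Proof.
move=> u v w; apply: wreathP => [x|]; last exact: mulgA.
by rewrite !wbase_mul /= ractM mulgA.
Qed.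

Lemma wreath_mul1 : left_id wreath_one wreath_mul.
Proof.
move=> u; apply: wreathP => [x|]; last exact: mul1g.
by rewrite wbase_mul wbase_one /= ract1 mul1g.
Qed.

Lemma wreath_mulr1 : right_id wreath_one wreath_mul.
Proof.
move=> u; apply: wreathP => [x|]; last exact: mulg1.
by rewrite wbase_mul wbase_one mulg1.
Qed.

Lemma wreath_mulV : left_inverse wreath_one wreath_inv wreath_mul.
Proof.
move=> u; apply: wreathP => [x|]; last exact: mulVg.
by rewrite wbase_mul wbase_inv wbase_one mulVg.
Qed.

Lemma wreath_mulrV : right_inverse wreath_one wreath_inv wreath_mul.
Proof.
move=> u; apply: wreathP => [x|]; last exact: mulgV.
by rewrite wbase_mul wbase_inv wbase_one -ractM mulgV ract1 mulgV.
Qed.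

HB.instance Definition _ := isGroup.Build W
  wreath_mulA wreath_mul1 wreath_mulr1 wreath_mulV wreath_mulrV.

Definition base_elt (x : X) (g : G) : W :=
  Wreath [fsfun [fsfun] with x |-> g] 1.

Definition top_elt (h : H) : W := Wreath [fsfun] h.

Lemma wreath_conj x g h : base_elt x g ^ top_elt h = base_elt (to x h) g.
Proof.
apply: wreathP => [y|]; last by rewrite /= mul1g mulVg.
rewrite /conjg [LHS]wbase_mul [X in _ * X]wbase_mul [X in X * _]wbase_inv /=.
rewrite !fsfun_withE !fsfun0E invg1 mul1g mulg1.
have -> : (to y h^-1 == x) = (y == to x h) => [|//].
by apply/eqP/eqP=> [<-|->]; rewrite -ractM ?mulVg ?mulgV ract1.
Qed.

End WreathProduct.

(* Main.v *)
Require Import Defs.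
From mathcomp Require Import all_boot.
From mathcomp Require Import finmap.
From mathcomp Require Import boolp classical_sets cardinality.

(** Let [W] be the wreath product and [B] its base group.  The point is to
enlarge an invariable generating set [S] of [H] to one of [W], even when [G]
itself has no invariable generating set.  Conjugating [g^(x)] in [W] replaces
[g] by a conjugate in [G], so elements of [B] alone cannot help.  What does
survive conjugation is the lamplighter element [g^(x) k], for a point [x] whose
orbit under [k] is infinite: its [n]-th power carries the copy of [G] at
[x k^-i] to the copy at [x k^j], where [n = i + j], and on the way conjugates it
by [g] exactly once, when it passes [x].  A conjugate by an element [f] of [B]
does the same as soon as [x k^-i] and [x k^j] lie outside the finite support of
[f] ([lamplighterJ]).  The element [g] is thus recovered exactly, and not merely
up to conjugacy.

Not being of torsion type means that every orbit of [H] on [X] contains a point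
[x] with [x<k>] infinite for some [k].  Choose such a pair for each orbit, and a
generating set [T] of [G] containing [1].  The candidate [wreath_gens] consists
of [S] and, for each chosen pair and each [g] in [T], of [g^(x)] and [g^(x) k].
Let [L] be generated by arbitrary conjugates of these.
- [L] maps onto [H], because [S] invariably generates [H].  The conjugators may
  therefore be taken in [B] ([conj_by_base]).
- The conjugate of [1^(x) k = k] moves elements far along the infinite cycle
  without changing them, and that of [g^(x) k] moves them while conjugating by
  [g].  Combining the two, at a suitable point [z] of the cycle, the trace of [L]
  on the copy of [G] at [z] is normalised by [T], hence by [G]
  ([base_orbit_sub]).
- A conjugate of each [g] in [T] lies in that trace, because of the generator
  [g^(x)].  The trace being normal, it contains [T], so it is the whole copy.
- As [L] maps onto [H], it contains all copies in the orbit, hence [B], hence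
  [W] ([wreath_gens_invariable]).

If [W] is finitely generated, then [G] is too and [X] has finitely many orbits
([finitely_generated_base]), so the candidate can be chosen finite when [S] is;
this gives (i).  For (ii) and (iii) the candidate is taken with all of [G] and
all points of [X], and [FIG W] is excluded since it implies that [W] is finitely
generated and that its quotient [H] is FIG ([FIG_wreath_top]). *)

Set Implicit Arguments.
Unset Strict Implicit.
Unset Printing Implicit Defensive.

Local Open Scope classical_set_scope.
Local Open Scope group_scope.

(** * Subgroups and generating sets *)

Section Subgroups.
Variable K : groupType.
Implicit Types (A S : set K) (x y : K).

Lemma subgroup1 A : subgroup A -> A 1.
Proof. by case. Qed.

Lemma subgroupV A x : subgroup A -> A x -> A x^-1.
Proof. by case=> A1 AD Ax; rewrite -[x^-1]mul1g; apply: AD. Qed.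

Lemma subgroupM A x y : subgroup A -> A x -> A y -> A (x * y).
Proof.
by move=> sA Ax Ay; rewrite -[y]invgK; apply: (proj2 sA) => //; apply: subgroupV.
Qed.

Lemma subgroupX A x n : subgroup A -> A x -> A (x ^+ n).
Proof.
move=> sA Ax; elim: n => [|n IHn]; first exact: subgroup1.
by rewrite expgS; apply: subgroupM.
Qed.

Lemma subgroupJ A x y : subgroup A -> A y -> A (x ^ y) <-> A x.
Proof.
move=> sA Ay; have AV := subgroupV sA Ay; split=> [Axy|Ax].
  by rewrite -[x](conjgK y) conjgE invgK; do 2 ?apply: subgroupM.
by rewrite conjgE; do 2 ?apply: subgroupM.
Qed.

Lemma generated_subgroup S : subgroup (generated S).
Proof.
split=> [|x y Sx Sy] A [sA SA]; first exact: subgroup1.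
by apply: (proj2 sA); [apply: Sx | apply: Sy].
Qed.

Lemma sub_generated S x : S x -> generated S x.
Proof. exact: sub_gen_smallest. Qed.

Lemma generated_full S A :
  generated S = [set: K] -> subgroup A -> S `<=` A -> forall x, A x.
Proof.
move=> genS sA SA x; have : generated S x by rewrite genS.
exact: smallest_sub.
Qed.

End Subgroups.

Lemma FIG_finitely_generated (K : groupType) : FIG K -> finitely_generated K.
Proof.
case=> S [finS genS]; exists S; split=> //.
by rewrite -(genS (fun=> 1)); congr generated; apply/seteqP; split=> x;
  [exists x; rewrite ?conjg1 | case=> s Ss <-; rewrite conjg1].
Qed.

(** Points far enough along an infinite cycle escape the support of a base
element. *)
Lemma injective_avoids_seq (T : eqType) (phi : nat -> T) (s : seq T) :
  injective phi -> exists M, forall i, M <= i -> phi i \notin s.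
Proof.
move=> phi_inj; elim: s => [|y s [M sM]]; first by exists 0.
have [[i0 phi_i0]|no_i] := pselect (exists i, phi i = y).
  exists (maxn M i0.+1) => i; rewrite geq_max inE => /andP[Mi i0i].
  rewrite negb_or sM // andbT -phi_i0 (inj_eq phi_inj).
  by rewrite eq_sym ltn_eqF.
exists M => i Mi; rewrite inE negb_or sM // andbT.
by apply/eqP=> phi_i; apply: no_i; exists i.
Qed.

(** * Points with an infinite orbit under a cyclic subgroup *)

Section InfiniteCycles.
Variables (H : groupType) (X : choiceType) (to : raction H X).

Definition infinite_cycle (x : X) (k : H) :=
  ~ finite_set [set to x g | g in generated [set k]].

Lemma ractK h : cancel (to^~ h) (to^~ h^-1).
Proof. by move=> x; rewrite -ractM mulgV ract1. Qed.

Lemma ractVK h : cancel (to^~ h^-1) (to^~ h).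
Proof. by move=> x; rewrite -ractM mulVg ract1. Qed.

(** If [x k^(n+1) = x], then the points [x k^i] with [i <= n] are permuted by
[k], and form a finite set containing [x<k>]. *)
Lemma infinite_cycle_free x k n : infinite_cycle x k -> to x (k ^+ n.+1) <> x.
Proof.
move=> infx fixx; apply: infx.
pose F := [set to x (k ^+ i) | i in `I_n.+1].
have finF : finite_set F by exact: finite_image.
apply: sub_finite_set finF => _ [g kg <-].
pose A := [set g | forall y, F y -> F (to y g) /\ F (to y g^-1)].
have F_in i : i <= n -> F (to x (k ^+ i)) by move=> lein; exists i.
have sA : subgroup A.
  split=> [y Fy|h l Ah Al y Fy]; first by rewrite invg1 ract1.
  rewrite invgF !ractM; split.
    by apply: (proj2 (Al _ _)); apply: (proj1 (Ah _ _)).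
  by apply: (proj2 (Ah _ _)); apply: (proj1 (Al _ _)).
have kA : [set k] `<=` A.
  move=> _ -> _ [i /= ltin <-]; rewrite -ractM -expgSr; split.
    case: (ltnP i n) => [/F_in //|lein].
    suff -> : i = n by rewrite fixx -[x](ract1 to) -(expg0 k); apply: F_in.
    by apply/eqP; rewrite eqn_leq lein -ltnS ltin.
  case: i ltin => [_|i /ltnW ltin]; last by rewrite expgSr ractM ractK; apply: F_in.
  by rewrite expg0 ract1 -[X in to X _]fixx expgSr ractM ractK; apply: F_in.
have Ag : A g := smallest_sub sA kA kg.
by have [] // := Ag x; rewrite -[x](ract1 to) -(expg0 k); apply: F_in.
Qed.

Lemma infinite_cycle_inj x k :
  infinite_cycle x k -> injective (fun i => to x (k ^+ i)).
Proof.
move=> infx; suff lt_neq i j : i < j -> to x (k ^+ i) <> to x (k ^+ j).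
  by move=> i j eq_ij; case: (ltngtP i j) => // /lt_neq; rewrite eq_ij.
move=> ltij eq_ij; apply: (infinite_cycle_free (n := (j - i).-1) infx).
rewrite prednK ?subn_gt0 // -[RHS](ractK (k ^+ i)) /= eq_ij -ractM.
by rewrite expgnFr // ltnW.
Qed.

Lemma infinite_cycle_injV x k :
  infinite_cycle x k -> injective (fun i => to x (k ^+ i)^-1).
Proof.
move=> infx i j /= eq_ij; apply/esym/(infinite_cycle_inj infx) => /=.
rewrite -[in LHS](ractVK (k ^+ i) x) eq_ij -!ractM; congr (to x _).
by rewrite -?mulgA -expgnDr addnC expgnDr mulKg.
Qed.

End InfiniteCycles.

(** * Computations in the wreath product *)

Section WreathElements.
Variables (G H : groupType) (X : choiceType) (to : raction H X).
Notation W := (wreath G to).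
Notation base := (@base_elt G H X to).
Notation top := (@top_elt G H X to).
Implicit Types (x y z : X) (g u : G) (h k : H) (f v w : W).

Lemma wbaseM v w x : wbase (v * w) x = wbase v x * wbase w (to x (wtop v)).
Proof. exact: wbase_mul. Qed.

Lemma wbase1 x : wbase (1 : W) x = 1.
Proof. exact: wbase_one. Qed.

Lemma wbaseV w x : wbase w^-1 x = (wbase w (to x (wtop w)^-1))^-1.
Proof. exact: wbase_inv. Qed.

Lemma wtopM v w : wtop (v * w) = wtop v * wtop w.
Proof. by []. Qed.

Lemma wtopV w : wtop w^-1 = (wtop w)^-1.
Proof. by []. Qed.

Lemma wtopJ v w : wtop (v ^ w) = wtop v ^ wtop w.
Proof. by []. Qed.

Lemma wtopX w n : wtop (w ^+ n) = wtop w ^+ n.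
Proof. by elim: n => // n IHn; rewrite !expgS wtopM IHn. Qed.

Lemma wbase_base_elt x g z : wbase (base x g) z = if z == x then g else 1.
Proof. by rewrite /= fsfun_withE fsfun0E. Qed.

Lemma wbase_top_elt h z : wbase (top h) z = 1.
Proof. by rewrite /= fsfun0E. Qed.

Lemma base_eltM x g u : base x (g * u) = base x g * base x u.
Proof.
apply: wreathP => [z|]; last by rewrite wtopM mulg1.
rewrite wbaseM /= ract1 !wbase_base_elt.
by case: eqP; rewrite ?mulg1.
Qed.

Lemma base_elt1 x : base x 1 = 1.
Proof. by apply: wreathP => // z; rewrite wbase_base_elt wbase1 if_same. Qed.

Lemma base_eltV x g : base x g^-1 = (base x g)^-1.
Proof. by apply/esym/mulg1_eq; rewrite -base_eltM mulgV base_elt1. Qed.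

Lemma base_eltJ x u w : base x u ^ w = base (to x (wtop w)) (u ^ wbase w x).
Proof.
apply: wreathP => [z|]; last by rewrite wtopJ conj1g.
rewrite conjgE !wbaseM wbaseV wtopV /= ract1 !wbase_base_elt.
have -> : (to z (wtop w)^-1 == x) = (z == to x (wtop w)).
  by apply/eqP/eqP=> [<-|->]; rewrite ?ractVK ?ractK.
by case: eqP => [->|_]; rewrite ?ractK // mul1g mulVg.
Qed.

(** The base group is a restricted product: a finite support can be cleared
one point at a time. *)
Lemma base_subgroup_full L :
  subgroup L -> (forall x g, L (base x g)) -> forall w, wtop w = 1 -> L w.
Proof.
move=> sL Lbase w; have [s] : exists s : seq X, {subset finsupp (wbase w) <= s}.
  by exists (finsupp (wbase w)).
elim: s w => [|y s IHs] w ws w1.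
  suff -> : w = 1 by apply: subgroup1.
  apply: wreathP => // z; rewrite wbase1; apply: fsfun_dflt.
  by apply/negP=> /ws.
have -> : w = base y (wbase w y) * ((base y (wbase w y))^-1 * w) by rewrite mulVKg.
apply: subgroupM => //; apply: IHs; last by rewrite wtopM wtopV w1 invg1 mulg1.
move=> z; rewrite mem_finsupp -base_eltV wbaseM /= ract1 wbase_base_elt.
case: (eqVneq z y) => [->|nzy]; first by rewrite mulVg eqxx.
by rewrite mul1g -mem_finsupp => /ws; rewrite inE (negbTE nzy).
Qed.

(** The product of the values of [g^(x) k] along the walk from [x k^-i] to
[x k^(j+1)] is exactly [g], since the walk leaves [x] once and never returns.
Conjugation by [f] only affects the two ends of the walk, where it is trivial. *)
Lemma lamplighterJ x k g f u i j : infinite_cycle to x k -> wtop f = 1 ->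
  wbase f (to x (k ^+ i)^-1) = 1 -> wbase f (to x (k ^+ j.+1)) = 1 ->
  base (to x (k ^+ i)^-1) u ^ ((base x g * top k) ^ f) ^+ (i + j.+1)
    = base (to x (k ^+ j.+1)) (u ^ g).
Proof.
move=> infx f1 fi fj; set d := base x g * top k.
have dk : wtop d = k by rewrite wtopM mul1g.
have d_base z : wbase d z = if z == x then g else 1.
  by rewrite wbaseM wbase_base_elt wbase_top_elt mulg1.
have d_before n : wbase (d ^+ n) (to x (k ^+ n)^-1) = 1.
  elim: n => [|n IHn]; first by rewrite wbase1.
  rewrite expgS wbaseM dk d_base ifN; last first.
    apply/eqP=> /(congr1 (to^~ (k ^+ n.+1))); rewrite /= ractVK => /esym.
    exact: infinite_cycle_free.
  by rewrite mul1g expgS invgM ractM ractVK.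
have d_after n : wbase (d ^+ n) (to x k) = 1.
  elim: n => [|n IHn]; first by rewrite wbase1.
  rewrite expgSr wbaseM wtopX dk d_base IHn mul1g -ractM -expgS.
  by rewrite ifN //; apply/eqP; apply: infinite_cycle_free.
have d_at : wbase (d ^+ (i + j.+1)) (to x (k ^+ i)^-1) = g.
  rewrite expgnDr wbaseM d_before mul1g wtopX dk ractVK.
  by rewrite expgS wbaseM dk d_base eqxx d_after mulg1.
rewrite -conjXg [X in _ ^ X]conjgE !conjgM.
have -> : base (to x (k ^+ i)^-1) u ^ f^-1 = base (to x (k ^+ i)^-1) u.
  by apply: (canLR (conjgK f)); rewrite base_eltJ f1 fi conjg1 ract1.
rewrite base_eltJ d_at wtopX dk expgnDr ractM ractVK.
by rewrite base_eltJ f1 fj conjg1 ract1.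
Qed.

(** * Subgroups that project onto the top group *)

Section InvariableGeneration.
Variable L : set W.
Hypothesis sL : subgroup L.
Hypothesis L_top : forall h, exists2 w, L w & wtop w = h.

(** Divide the conjugator by an element of [L] with the same top component. *)
Lemma conj_by_base v w : L (v ^ w) -> exists2 f, wtop f = 1 & L (v ^ f).
Proof.
have [l Ll lw] := L_top (wtop w) => Lvw.
exists (w / l); first by rewrite wtopM wtopV lw mulgV.
by rewrite conjgM; apply/subgroupJ => //; apply: subgroupV.
Qed.

Lemma move_base_elt x h g : L (base x g) -> exists u, L (base (to x h) (g ^ u)).
Proof.
have [l Ll <-] := L_top h => Lxg; exists (wbase l x).
by rewrite -base_eltJ; apply/subgroupJ.
Qed.

(** The bound [M] depends on the unknown conjugator [w], hence on [g]: there need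
not be a common bound for infinitely many [g]. *)
Lemma lamplighter_transport x k g w : infinite_cycle to x k ->
  L ((base x g * top k) ^ w) ->
  exists M, forall i j u, M <= i -> M <= j ->
    L (base (to x (k ^+ i)^-1) u) <-> L (base (to x (k ^+ j.+1)) (u ^ g)).
Proof.
move=> infx /conj_by_base[f f1 Lf].
have [M1 fM1] := injective_avoids_seq (finsupp (wbase f)) (infinite_cycle_injV infx).
have [M2 fM2] := injective_avoids_seq (finsupp (wbase f)) (infinite_cycle_inj infx).
exists (maxn M1 M2) => i j u; rewrite !geq_max => /andP[M1i _] /andP[_ M2j].
have fi : wbase f (to x (k ^+ i)^-1) = 1 by apply: fsfun_dflt; apply: fM1.
have fj : wbase f (to x (k ^+ j.+1)) = 1.
  by apply: fsfun_dflt; apply: fM2; apply: leqW.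
rewrite -(lamplighterJ g u infx f1 fi fj).
by apply: iff_sym; apply: subgroupJ => //; apply: subgroupX.
Qed.

(** The reference point [z = x k^-M] depends only on the conjugate of [k], the
lamplighter element of [g = 1].  For other [g] the bound may be larger than [M],
and one first moves from [z] far back along the cycle by means of that conjugate
of [k]; the order of the moves is [x k^-M], [x k^(P+1)], [x k^-P], [x k^(P+1)],
[x k^-M], and only the third move conjugates by [g]. *)
Lemma base_orbit_sub (T : set G) x k : generated T = [set: G] -> T 1 ->
  infinite_cycle to x k ->
  (forall g, T g -> exists w, L (base x g ^ w)) ->
  (forall g, T g -> exists w, L ((base x g * top k) ^ w)) ->
  forall h g, L (base (to x h) g).
Proof.
move=> genT T1 infx Lbase Llamp.
have [w1 /(lamplighter_transport infx)[M LM]] := Llamp _ T1.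
pose z := to x (k ^+ M)^-1.
have stable_z g u : L (base z u) <-> L (base z (u ^ g)).
  move: g u; apply: (generated_full genT) => [|g Tg u].
    split=> [u|g1 g2 stab1 stab2 u]; first by rewrite conjg1.
    by rewrite conjgM (stab2 (_ ^ g2^-1)) conjgKV; apply: stab1.
  have [w /(lamplighter_transport infx)[N LN]] := Llamp _ Tg.
  have MP := leq_maxl M N; have NP := leq_maxr M N.
  (* The four moves, with P = maxn M N. *)
  rewrite (LM M (maxn M N)) // -(LM (maxn M N)) // (LN _ (maxn M N)) //.
  by rewrite (LM M (maxn M N) (u ^ g)) ?conjg1.
have Lz g : L (base z g).
  move: g; apply: (generated_full genT) => [|g Tg].
    split=> [|g1 g2 L1 L2]; first by rewrite base_elt1; apply: subgroup1.
    by rewrite base_eltM base_eltV; apply: (proj2 sL).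
  (* Only some conjugate of g reaches z; stability removes the conjugator. *)
  have [w] := Lbase _ Tg; rewrite base_eltJ.
  case/(move_base_elt ((wtop w)^-1 * (k ^+ M)^-1))=> u.
  by rewrite ractM ractK -conjgM -stable_z.
move=> h g; have [l Ll lh] := L_top (k ^+ M * h).
have -> : to x h = to z (wtop l) by rewrite lh ractM ractVK.
by rewrite -[g](conjgKV (wbase l z)) -base_eltJ; apply/subgroupJ.
Qed.

End InvariableGeneration.

(** * Generating sets of the wreath product *)

(** The pair [c y] is a point of the orbit of [y] together with an element of
[H] under which the orbit of that point is infinite. *)
Definition wreath_gens (S : set H) (T : set G) (Y : set X) (c : X -> X * H) :=
  [set top s | s in S]
  `|` [set base (c y).1 g | y in Y & g in T]
  `|` [set base (c y).1 g * top (c y).2 | y in Y & g in T].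

Lemma wreath_gens_finite S T Y c : finite_set S -> finite_set T ->
  finite_set Y -> finite_set (wreath_gens S T Y c).
Proof.
move=> finS finT finY; rewrite !finite_setU; do ?split.
- exact: finite_image.
- exact: finite_image2.
- exact: finite_image2.
Qed.

Lemma wreath_gens_invariable S T Y c :
  invariably_generates S -> generated T = [set: G] -> T 1 ->
  (forall x, exists2 y, Y y & orbit_of to y x) ->
  (forall y, orbit_of to y (c y).1 /\ infinite_cycle to (c y).1 (c y).2) ->
  invariably_generates (wreath_gens S T Y c).
Proof.
move=> genS genT T1 coverY cP a; set A := [set _ | _ in _].
have sL : subgroup (generated A) := generated_subgroup A.
have LA v : wreath_gens S T Y c v -> generated A (v ^ a v).
  by move=> gen_v; apply: sub_generated; exists v.
(* The choice of conjugators in W induces one in H, to which the hypothesis on S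
   applies. *)
have L_top h : exists2 w, generated A w & wtop w = h.
  move: h; apply: (generated_full (genS (fun s => wtop (a (top s))))).
    split=> [|h1 h2 [w1 L1 <-] [w2 L2 <-]]; first by exists 1 => //; apply: subgroup1.
    by exists (w1 / w2) => //; apply: (proj2 sL).
  by move=> _ [s Ss <-]; exists (top s ^ a (top s)) => //; apply: LA; left; left; exists s.
have Lbase x g : generated A (base x g).
  have [y Yy [h _ yh]] := coverY x; have [[l _ cl] infc] := cP y.
  have -> : x = to (c y).1 (l^-1 * h) by rewrite -cl ractM ractK yh.
  apply: (base_orbit_sub sL L_top genT T1 infc) => u Tu.
    by exists (a (base (c y).1 u)); apply: LA; left; right; exists y => //; exists u.
  exists (a (base (c y).1 u * top (c y).2)); apply: LA; right.
  by exists y => //; exists u.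
apply/seteqP; split=> // w _; have [l Ll lw] := L_top (wtop w).
rewrite -(mulgVK l w); apply: (subgroupM sL) => //.
by apply: (base_subgroup_full sL) => //; last by rewrite wtopM wtopV lw mulgV.
Qed.

(** The values of a finite generating set [A] generate [G], and the supports of
the elements of [A] meet every orbit: [W] would otherwise be contained in the
subgroup of elements with values in a proper subgroup of [G], or with support in
a proper [H]-invariant subset of [X]. *)
Lemma finitely_generated_base (x0 : X) : nontrivial G -> finitely_generated W ->
  (exists T : set G, finite_set T /\ generated T = [set: G]) /\
  (exists Y : set X, finite_set Y /\
     forall x, exists2 y, Y y & orbit_of to y x).
Proof.
move=> [g0 g0_neq1] [A [finA genA]].
pose Y := \bigcup_(w in A) [set` finsupp (wbase w)].
have finY : finite_set Y by apply: bigcup_finite => // w _; apply: finite_fset.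
split.
  exists [set wbase w y | w in A & y in Y]; split; first exact: finite_image2.
  set T := [set _ | _ in _ & _ in _]; apply/seteqP; split=> // g _.
  suff /(_ (base x0 g) x0) : forall w x, generated T (wbase w x).
    by rewrite wbase_base_elt eqxx.
  apply: (generated_full genA) => [|w Aw x].
    split=> [x|v w Tv Tw x]; first by rewrite wbase1; apply: subgroup1 (generated_subgroup T).
    rewrite wbaseM wbaseV.
    by apply: (proj2 (generated_subgroup T)).
  have [xw|/fsfun_dflt ->] := boolP (x \in finsupp (wbase w)).
    by apply: sub_generated; exists w => //; exists x => //; exists w.
  by apply: subgroup1 (generated_subgroup T).
exists Y; split=> // x.
have orbitM y z h : orbit_of to y (to z h) -> orbit_of to y z.
  by case=> l _ lz; exists (l / h) => //; rewrite ractM lz ractK.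
suff /(_ (base x g0) x) : forall w z, wbase w z <> 1 ->
    exists2 y, Y y & orbit_of to y z.
  by rewrite wbase_base_elt eqxx; apply; apply/eqP.
apply: (generated_full genA) => [|w Aw z /eqP wz].
  split=> [z|v w Yv Yw z]; first by rewrite wbase1.
  rewrite wbaseM wbaseV; have [vz|/Yv //] := pselect (wbase v z = 1).
  have [wz|/Yw [y Yy orby]] := pselect
      (wbase w (to (to z (wtop v)) (wtop w)^-1) = 1).
    by rewrite vz wz divg1.
  by move=> _; exists y => //; exact: orbitM (orbitM _ _ _ orby).
by exists z; [exists w => //=; rewrite mem_finsupp | exists 1; rewrite ?ract1].
Qed.

(** Conjugators in the quotient [H] lift to [W], so an invariable generating set
of [W] projects to one of [H]. *)
Lemma FIG_wreath_top : FIG W -> FIG H.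
Proof.
case=> A [finA genA]; exists [set wtop w | w in A]; split; first exact: finite_image.
move=> a; set B := [set _ | _ in _]; apply/seteqP; split=> // h _.
suff /(_ (top h)) : forall w, generated B (wtop w) by [].
apply: (generated_full (genA (fun w => top (a (wtop w))))).
  split=> [|v w Bv Bw]; first exact: subgroup1 (generated_subgroup B).
  exact: (proj2 (generated_subgroup B)).
move=> _ [w Aw <-]; apply: sub_generated.
by exists (wtop w); [exists w | rewrite wtopJ].
Qed.

Lemma not_torsion_choice : ~ torsion_type to -> exists c : X -> X * H,
  forall y, orbit_of to y (c y).1 /\ infinite_cycle to (c y).1 (c y).2.
Proof.
move=> not_tors.
suff /choice[c cP] : forall y, exists p : X * H,
    orbit_of to y p.1 /\ infinite_cycle to p.1 p.2 by exists c.
move=> y; apply: contrapT => no_p; apply: not_tors; exists y => x yx k.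
by apply: contrapT => infx; apply: no_p; exists (x, k).
Qed.

Lemma wreath_has_invariable : ~ torsion_type to ->
  (exists S : set H, invariably_generates S) ->
  exists A : set W, invariably_generates A.
Proof.
move=> /not_torsion_choice[c cP] [S genS].
exists (wreath_gens S setT setT c); apply: wreath_gens_invariable => //.
  by apply/seteqP; split=> // g _; apply: sub_generated.
by move=> x; exists x => //; exists 1; rewrite ?ract1.
Qed.

End WreathElements.

(** * Invariable generation of wreath products *)

Theorem theoremB (G H : groupType) (X : choiceType) (to : raction H X)
  (G_nontrivial : nontrivial G) (H_nontrivial : nontrivial H)
  (to_faithful : faithful_action to) (to_not_torsion : ~ torsion_type to) :
  (finitely_generated (wreath G to) -> FIG H -> FIG (wreath G to)) /\
  (~ finitely_generated (wreath G to) -> FIG H -> IG (wreath G to)) /\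
  (IG H -> IG (wreath G to)).
Proof.
split; last split.
- move=> fgW [S [finS genS]].
  (* An action on the empty set is faithful only for the trivial group. *)
  have [x0] : exists x0 : X, True.
    apply: contrapT => noX; have [h /eqP[]] := H_nontrivial.
    by apply: to_faithful => x; case: noX; exists x.
  move=> _.
  have [[T [finT genT]] [Y [finY coverY]]] :=
    finitely_generated_base x0 G_nontrivial fgW.
  have [c cP] := not_torsion_choice to_not_torsion.
  exists (wreath_gens S (1 |` T) Y c); split.
    by apply: wreath_gens_finite => //; rewrite finite_setU; split.
  apply: wreath_gens_invariable => //; last by left.
  apply/seteqP; split=> // g _; apply: (generated_full genT).
    exact: generated_subgroup.
  by move=> u Tu; apply: sub_generated; right.
- move=> nfgW [S [_ genS]]; split; first by apply: wreath_has_invariable => //; exists S.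
  by move/FIG_finitely_generated.
- move=> [exS nFIG]; split; first exact: wreath_has_invariable.
  by move/FIG_wreath_top.
Qed.
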